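(* Let $G$ be a graph with vertex set $\{0,1,\dots,n\}$ and sink $0$, and let $c\in\mathbb{Z}_{\ge 0}^n$ be a stable configuration on $G$. Then $c$ is a minimal SR state if and only if there exists a sink-rooted orientation $\mathcal{O}$ of $G$ with $c_i=\mathrm{in}^{\mathcal{O}}_i$ for all $i\in\{1,\dots,n\}$; and $c$ is a minimal DR state if and only if there exists an acyclic sink-rooted orientation $\mathcal{O}$ of $G$ with $c_i=\mathrm{in}^{\mathcal{O}}_i$ for all $i\in\{1,\dots,n\}$. Moreover, in the SR case such an orientation is unique up to score-equivalence, and in the DR case it is unique.
   Context: A graph $G$ here is a finite, connected, undirected multigraph without loops (multiple edges allowed) with vertex set $\{0,1,\dots,n\}$; vertex $0$ is the sink; $\deg(i)$ is the degree of $i$ counting multiplicity. A configuration is $c=(c_1,\dots,c_n)\in\mathbb{Z}_{\ge0}^n$ ($c_i$ grains at vertex $i$; the sink carries no grains). Vertex $i\in[n]$ is stable if $c_i<\deg(i)$, and $c$ is stable if all $i\in[n]$ are stable. Abelian sandpile model (ASM): an unstable vertex $i$ topples deterministically by sending one grain along each incident edge (with multiplicity) to the other endpoint; grains sent to the sink disappear. Stochastic sandpile model (SSM), with fixed parameter $p\in(0,1)$: an unstable vertex $i$ topples stochastically: for each incident edge (with multiplicity) independently, with probability $p$ one grain moves from $i$ along that edge to the other endpoint (disappearing if it is the sink), otherwise it stays at $i$. Repeated toppling of unstable vertices almost surely reaches a stable configuration (the stabilisation). Each model defines a Markov chain on stable configurations: at each step add a grain at vertex $i$ with probability $\mu_i>0$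 (a fixed distribution on $[n]$) and stabilise. Recurrent states of the ASM chain are called DR (deterministically recurrent), those of the SSM chain SR (stochastically recurrent); these sets do not depend on $p$ or $\mu$. A recurrent state is minimal if it is minimal among recurrent states for the componentwise order $c\preceq c' \iff c_i\le c'_i\ \forall i$. An orientation $\mathcal{O}$ of $G$ assigns a direction to each edge (each copy of a multiple edge separately); $\mathrm{in}^{\mathcal{O}}_i$ is the number of edges directed into $i$. A root is a vertex all of whose edges are incoming; $\mathcal{O}$ is sink-rooted if the sink is its unique root; acyclic if it has no directed cycle. Two orientations are score-equivalent if they have the same in-degree at every vertex. Known facts: a stable $c$ is SR iff there exists a sink-rooted orientation $\mathcal{O}$ with $c_i\ge \mathrm{in}^{\mathcal{O}}_i$ for all $i\in[n]$, and DR iff such an orientation exists that is additionally acyclic. *)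

(* Defs.v *)
From mathcomp Require Import all_boot all_order.
From Stdlib Require Import Relations.Relation_Operators.
Set Implicit Arguments. Unset Strict Implicit. Unset Printing Implicit Defensive.

(* A multigraph on vertex set 'I_n.+1 = {0,...,n}, sink = ord0, is given by a
   finite type E of edges (each copy of a multiple edge is a distinct element
   of E) and two endpoint maps src, tgt : E -> 'I_n.+1 (an arbitrary reference
   labelling of the two endpoints; the graph itself is undirected). *)
Section Sandpile.
Variables (n : nat) (E : finType) (src tgt : E -> 'I_n.+1).

Definition sink : 'I_n.+1 := ord0.
Definition vtx (i : 'I_n) : 'I_n.+1 := lift ord0 i.

Definition incident (e : E) (v : 'I_n.+1) : bool := (src e == v) || (tgt e == v).
Definition other_end (e : E) (v : 'I_n.+1) : 'I_n.+1 :=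
  if src e == v then tgt e else src e.
Definition adj (u w : 'I_n.+1) : bool :=
  [exists e, ((src e == u) && (tgt e == w)) || ((src e == w) && (tgt e == u))].

Definition loopless : Prop := forall e, src e != tgt e.
Definition connected_graph : Prop := forall u w, connect adj u w.
Definition is_graph : Prop := loopless /\ connected_graph.

Definition deg (v : 'I_n.+1) : nat := #|[set e | incident e v]|.

Definition config := {ffun 'I_n -> nat}.

Definition stable (c : config) : bool := [forall i, c i < deg (vtx i)].

(* vertex i (unstable) sends one grain along each edge of S, where S is a set
   of edges incident to i; grains reaching the sink disappear *)
Definition topple_along (c : config) (i : 'I_n) (S : {set E}) : config :=
  [ffun j => c j + #|[set e in S | other_end e (vtx i) == vtx j]|
             - (j == i) * #|S|].

(* one stochastic toppling: for each incident edge independently a grain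
   moves with probability p in (0,1), so every subset S of the incident
   edges has positive probability *)
Definition ssm_step (c c' : config) : Prop :=
  exists i, deg (vtx i) <= c i /\
    exists S : {set E}, S \subset [set e | incident e (vtx i)] /\
      c' = topple_along c i S.

Definition asm_step (c c' : config) : Prop :=
  exists i, deg (vtx i) <= c i /\
    c' = topple_along c i [set e | incident e (vtx i)].

Definition add_grain (c : config) (i : 'I_n) : config :=
  [ffun j => c j + (j == i)].

(* transition relation (support) of the Markov chain on stable configurations:
   add a grain at some vertex i (mu_i > 0) and stabilise *)
Definition chain_step (step : config -> config -> Prop) (c c' : config) : Prop :=
  stable c /\ stable c' /\
  exists i, clos_refl_trans config step (add_grain c i) c'.

Definition recurrent (step : config -> config -> Prop) (c : config) : Prop :=
  stable c /\
  forall c', clos_refl_trans config (chain_step step) c c' ->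
             clos_refl_trans config (chain_step step) c' c.

Definition SR (c : config) : Prop := recurrent ssm_step c.
Definition DR (c : config) : Prop := recurrent asm_step c.

Definition minimal_in (P : config -> Prop) (c : config) : Prop :=
  P c /\ forall c', P c' -> (forall i, c' i <= c i) -> c' = c.

Definition orientation := {ffun E -> bool}.
Definition head (O : orientation) (e : E) : 'I_n.+1 := if O e then tgt e else src e.
Definition tail (O : orientation) (e : E) : 'I_n.+1 := if O e then src e else tgt e.
Definition indeg (O : orientation) (v : 'I_n.+1) : nat := #|[set e | head O e == v]|.
Definition is_root (O : orientation) (v : 'I_n.+1) : Prop :=
  forall e, incident e v -> head O e = v.
Definition sink_rooted (O : orientation) : Prop :=
  is_root O sink /\ forall v, is_root O v -> v = sink.
Definition arc (O : orientation) (u w : 'I_n.+1) : bool :=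
  [exists e, (tail O e == u) && (head O e == w)].
Definition acyclic (O : orientation) : Prop :=
  forall u w, arc O u w -> ~~ connect (arc O) w u.
Definition score_equiv (O1 O2 : orientation) : Prop :=
  forall v, indeg O1 v = indeg O2 v.
Definition config_is_indeg (c : config) (O : orientation) : Prop :=
  forall i, c i = indeg O (vtx i).

End Sandpile.

(* Main.v *)
(* A stable configuration is recurrent iff it is reachable from the maximal stable
   one. Lying above the in-degrees of some (acyclic) orientation rooted at the sink
   is preserved by stochastic (deterministic) topplings, which only turn edges
   outwards at the toppled vertex; a stable configuration above in-degrees has no
   other root. Conversely, if O is acyclic with configuration c, then adding to c
   one grain along each sink edge and toppling every vertex once, in the order
   given by O, restores c, so c is recurrent for the ASM. Starting from such a c
   and the same added grains, the SSM can topple along smaller edge sets and end in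
   the in-degrees of any orientation rooted at the sink. By the abelian property
   the grains may be added one at a time, stabilising in between. Minimality
   follows because all these in-degree configurations have the same number of
   grains. *)
Require Import Defs.
From mathcomp Require Import all_boot all_order.
From mathcomp Require Import zify.
From Stdlib Require Import Relations.Relation_Operators.
Set Implicit Arguments. Unset Strict Implicit. Unset Printing Implicit Defensive.

Section ClosReflTrans.
Variables (T : Type) (R R' : T -> T -> Prop).

Lemma clos_rt_sub (x y : T) :
  (forall u v, R u v -> R' u v) ->
  clos_refl_trans T R x y -> clos_refl_trans T R' x y.
Proof.
move=> sRR'; elim=> {x y} [x y /sRR' ? | x | x y z _ xy _ yz].
- exact: rt_step.
- exact: rt_refl.
- exact: rt_trans xy yz.
Qed.

Lemma clos_rt_inv (P : T -> Prop) (x y : T) :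
  (forall u v, R u v -> P u -> P v) -> clos_refl_trans T R x y -> P x -> P y.
Proof.
move=> PR; elim=> {x y} [x y /PR // | // | x y z _ xy _ yz /xy /yz //].
Qed.

End ClosReflTrans.

Section Sandpile.
Variables (n : nat) (E : finType) (src tgt : E -> 'I_n.+1).

Local Notation sink := (sink n).
Local Notation deg := (deg src tgt).
Local Notation inc i := [set e | incident src tgt e (vtx i)].
Local Notation other_end := (other_end src tgt).
Local Notation topple := (topple_along src tgt).
Local Notation stable := (stable src tgt).
Local Notation head := (Defs.head src tgt).
Local Notation tail := (Defs.tail src tgt).
Local Notation indeg := (indeg src tgt).
Local Notation is_root := (is_root src tgt).
Local Notation arc := (Defs.arc src tgt).
Local Notation ssm_step := (@ssm_step n E src tgt).
Local Notation asm_step := (@asm_step n E src tgt).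

Implicit Types (c d x y s : config n) (i j : 'I_n) (S : {set E}).
Implicit Types (O A : orientation E) (e : E).

Definition addc x y : config n := [ffun i => x i + y i].
Definition mulc m x : config n := [ffun i => m * x i].

Lemma vtx_inj : injective (@vtx n).
Proof. exact: lift_inj. Qed.

Lemma vtx_eq i j : (vtx i == vtx j) = (i == j).
Proof. exact: inj_eq vtx_inj i j. Qed.

Lemma vtx_sink i : (vtx i == sink) = false.
Proof. by []. Qed.

Lemma sink_vtx i : (sink == vtx i) = false.
Proof. by []. Qed.

Lemma vtxP (v : 'I_n.+1) : v != sink -> exists i, v = vtx i.
Proof.
rewrite eq_sym => /unlift_some[i -> _]; by exists i.
Qed.

(** * Legal toppling sequences *)

Section Topplings.
Variable al : 'I_n -> {set E} -> Prop.
Hypothesis al_sub : forall i S, al i S -> S \subset inc i.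

(* [al i S] says that vertex [i] may topple along exactly the edges of [S]; the
   ASM allows only [S = inc i] and the SSM every subset of [inc i]. *)
Definition topple_step x y : Prop :=
  exists i, deg (vtx i) <= x i /\ exists S, al i S /\ y = topple x i S.

Fixpoint topples m x y : Prop :=
  if m is m'.+1 then
    exists i S, [/\ deg (vtx i) <= x i, al i S & topples m' (topple x i S) y]
  else x = y.

Lemma al_card i S : al i S -> #|S| <= deg (vtx i).
Proof. by move=> /al_sub; apply: subset_leq_card. Qed.

Lemma topple_other x i j S : j != i -> x j <= topple x i S j.
Proof. by rewrite ffunE => /negbTE->; lia. Qed.

Lemma topple_comm x i j S S' : i != j ->
  #|S| <= x i -> #|S'| <= x j ->
  topple (topple x i S) j S' = topple (topple x j S') i S.
Proof.
move=> ij Si Sj; apply/ffunP=> l; rewrite !ffunE.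
have [li|li] := eqVneq l i; have [lj|lj] := eqVneq l j; subst; lia.
Qed.

Lemma topple_addc x d i S : #|S| <= x i ->
  topple (addc x d) i S = addc (topple x i S) d.
Proof.
move=> Si; apply/ffunP=> l; rewrite !ffunE.
have [li|li] := eqVneq l i; subst; lia.
Qed.

Lemma topples_addc m x y d : topples m x y -> topples m (addc x d) (addc y d).
Proof.
elim: m x => [|m IH] x /= => [-> //|[i [S [xi aS /IH tm]]]].
exists i, S; split=> //; first by rewrite ffunE; lia.
by rewrite topple_addc //; have := al_card aS; lia.
Qed.

Lemma topples_trans m m' x y z :
  topples m x y -> topples m' y z -> topples (m + m') x z.
Proof.
elim: m x => [|m IH] x /= => [-> //|[i [S [xi aS tm]]] tm'].
by exists i, S; split=> //; apply: IH.
Qed.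

Lemma topples_clos m x y :
  topples m x y -> clos_refl_trans _ topple_step x y.
Proof.
elim: m x => [|m IH] x /= => [->|[i [S [xi aS /IH tm]]]]; first exact: rt_refl.
by apply: rt_trans tm; apply: rt_step; exists i; split=> //; exists S.
Qed.

Lemma stableP x : reflect (forall i, x i < deg (vtx i)) (stable x).
Proof. exact: forallP. Qed.

(* Abelian property: an unstable vertex topples eventually, and its first
   toppling can be moved to the front of the sequence. *)
Lemma topples_first m x s i : stable s -> topples m x s ->
  deg (vtx i) <= x i ->
  exists m' S, [/\ m = m'.+1, al i S & topples m' (topple x i S) s].
Proof.
move=> /stableP ss; elim: m x => [|m IH] x /=.
  by move=> -> si; have := ss i; lia.
case=> j [S [xj aS tm]] xi.
have [eij|ij] := eqVneq i j; first by subst j; exists m, S.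
have [|m' [S' [-> aS' tm']]] := IH _ tm.
  exact: leq_trans xi (topple_other _ _ ij).
exists m'.+1, S'; split=> //=; exists j, S; split=> //.
  by apply: leq_trans xj (topple_other _ _ _); rewrite eq_sym.
by rewrite topple_comm //; have := al_card aS; have := al_card aS'; lia.
Qed.

(** A vertex unstable in [x] is unstable in [addc x d] too, so its toppling can be moved to the
    front. This shortens the sequence, and [d] just lies on top until [x] is stable. *)
Lemma topples_stabilise m x d s : stable s -> topples m (addc x d) s ->
  exists y m1 m2, [/\ stable y, topples m1 x y & topples m2 (addc y d) s].
Proof.
move=> ss; elim: m x => [|m IH] x tm;
    (have [sx|/forallPn[i]] := boolP (stable x);
      [by exists x, 0; eexists; split=> //; exact: tm | rewrite -leqNgt => xi]);
    have [|m' [S [em aS]]] := topples_first (i := i) ss tm;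
    rewrite ?ffunE; try lia; move: em => [] // <-.
rewrite topple_addc; last by have := al_card aS; lia.
move=> /IH[y [m1 [m2 [sy t1 t2]]]]; exists y, m1.+1, m2; split=> //=.
by exists i, S.
Qed.

(** Induction on the number of grains in [d]: one grain joins [x], which is stabilised before the
    others follow. With no grains left, a stable [x] admits no toppling. *)
Lemma topples_chain m x d s : stable x -> stable s -> topples m (addc x d) s ->
  clos_refl_trans _ (chain_step src tgt topple_step) x s.
Proof.
move=> sx ss; move: {2}(\sum_i d i) (erefl (\sum_i d i)) => N.
elim: N m x d sx => [|N IH] m x d sx dN tm.
  have d0 i : d i = 0 by move/eqP: dN; rewrite sum_nat_eq0 => /forallP/(_ i)/eqP.
  have xd : addc x d = x by apply/ffunP=> i; rewrite ffunE d0 addn0.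
  rewrite xd in tm.
  case: m tm => [->|m /= [i [S [xi _ _]]]]; first exact: rt_refl.
  by have /stableP/(_ i) := sx; lia.
have [i di] : exists i, 0 < d i.
  have : \sum_i d i != 0 by rewrite dN.
  by rewrite sum_nat_eq0 negb_forall => /existsP[i]; exists i; rewrite lt0n.
pose d' : config n := [ffun j => d j - (j == i)].
have xd : addc x d = addc (add_grain x i) d'.
  by apply/ffunP=> j; rewrite !ffunE; case: eqVneq => [->|]; lia.
rewrite xd in tm.
have [y [m1 [m2 [sy t1 t2]]]] := topples_stabilise ss tm.
apply: rt_trans (IH _ _ _ sy _ t2).
  by apply: rt_step; split=> //; split=> //; exists i; apply: topples_clos t1.
rewrite (bigD1 i) //= ffunE eqxx; move: dN; rewrite (bigD1 i) //=.
have -> : \sum_(j | j != i) d' j = \sum_(j | j != i) d j.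
  by apply: eq_bigr => j /negbTE ji; rewrite ffunE ji subn0.
by case: (d i) di => // u _; rewrite addSn subn1 => -[<-].
Qed.

Lemma le_chain x y : stable x -> stable y -> (forall i, x i <= y i) ->
  clos_refl_trans _ (chain_step src tgt topple_step) x y.
Proof.
move=> sx sy xy; apply: (@topples_chain 0 x [ffun i => y i - x i]) => //=.
by apply/ffunP=> i; rewrite !ffunE subnKC.
Qed.

End Topplings.

(** * Reachability in the two models *)

Definition ssm_al i S : Prop := S \subset inc i.
Definition asm_al i S : Prop := S = inc i.

Lemma ssm_al_sub i S : ssm_al i S -> S \subset inc i. Proof. by []. Qed.
Lemma asm_al_sub i S : asm_al i S -> S \subset inc i. Proof. by move=> ->. Qed.

(** An ASM toppling is determined by its vertex, so the toppling moved to the front of the sequence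
    to [s] is the very one that starts the sequence to [y]. *)
Lemma asm_confluent m m' x y s : stable s ->
  topples asm_al m x s -> topples asm_al m' x y ->
  exists m'', topples asm_al m'' y s.
Proof.
move=> ss; elim: m' m x => [|m' IH] m x tm /= => [<-|[i [S [xi -> tm']]]].
  by exists m.
have [m1 [S1 [_ -> t1]]] := topples_first asm_al_sub ss tm xi.
exact: IH t1 tm'.
Qed.

Lemma chain_sub (R R' : config n -> config n -> Prop) x y :
  (forall u v, R u v -> R' u v) ->
  clos_refl_trans _ (chain_step src tgt R) x y ->
  clos_refl_trans _ (chain_step src tgt R') x y.
Proof.
move=> sRR'; apply: clos_rt_sub => u v [su [sv [i uv]]].
by split=> //; split=> //; exists i; apply: clos_rt_sub uv.
Qed.

Lemma asm_step_ssm x y : asm_step x y -> ssm_step x y.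
Proof. by case=> i [xi ->]; exists i; split=> //; exists (inc i). Qed.

Lemma topple_step_asm x y : topple_step asm_al x y -> asm_step x y.
Proof. by case=> i [xi [S [-> ->]]]; exists i. Qed.

Definition max_stable : config n := [ffun i => (deg (vtx i)).-1].

Lemma stable_le_max c : stable c -> forall i, c i <= max_stable i.
Proof. by move=> /stableP sc i; rewrite ffunE; have := sc i; lia. Qed.

Lemma stable_le x y : (forall i, x i <= y i) -> stable y -> stable x.
Proof. by move=> xy /stableP sy; apply/stableP=> i; apply: leq_ltn_trans (sy i). Qed.

Lemma stable_max c : stable c -> stable max_stable.
Proof.
by move=> /stableP sc; apply/stableP=> i; rewrite ffunE; have := sc i; lia.
Qed.

Lemma chain_max (R : config n -> config n -> Prop) c : stable c ->
  clos_refl_trans _ (chain_step src tgt R) c max_stable.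
Proof.
(* Only grains need adding, so a relation without any legal toppling suffices, and its chain embeds
   in that of every [R]. *)
move=> sc; apply: (@chain_sub (topple_step (fun _ _ => False))).
  by move=> u v [i [_ [S []]]].
by apply: le_chain (stable_max sc) (stable_le_max sc).
Qed.

Lemma recurrentP (R : config n -> config n -> Prop) c : stable c ->
  recurrent src tgt R c <->
  clos_refl_trans _ (chain_step src tgt R) max_stable c.
Proof.
move=> sc; split=> [[_]|Mc]; first by apply; apply: chain_max.
split=> // c' cc'; apply: rt_trans Mc; apply: chain_max.
by apply: (clos_rt_inv (P := fun x => stable x)) cc' sc => u v [_ []].
Qed.

(** * Orientations *)

Hypothesis loopl : loopless src tgt.
Hypothesis conn : connected_graph src tgt.

Definition indeg_config O : config n := [ffun i => indeg O (vtx i)].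

(** A topological order certifying acyclicity; a toppling updates it by changing one rank. *)
Definition rank_dec (k : 'I_n.+1 -> nat) O : Prop :=
  forall e, k (head O e) < k (tail O e).

Lemma cards_sum (P : pred E) : #|[set e | P e]| = \sum_e P e.
Proof. by rewrite -sum1dep_card big_mkcond; apply: eq_bigr => e _; case: (P e). Qed.

Lemma incidentE O e v :
  incident src tgt e v = (head O e == v) || (tail O e == v).
Proof. by rewrite /incident /Defs.head /Defs.tail; case: (O e); rewrite // orbC. Qed.

Lemma head_tail O e : head O e != tail O e.
Proof. by rewrite /Defs.head /Defs.tail; case: (O e); rewrite // eq_sym. Qed.

Lemma head_flip O O' e : O e != O' e -> head O' e = tail O e.
Proof. by rewrite /Defs.head /Defs.tail; case: (O e) (O' e) => [] []. Qed.

Lemma other_end_head O e : other_end e (head O e) = tail O e.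
Proof.
rewrite /Defs.other_end /Defs.head /Defs.tail; case: (O e); rewrite ?eqxx //.
by rewrite (negbTE (loopl e)).
Qed.

Lemma other_end_neq e v : incident src tgt e v -> other_end e v != v.
Proof.
rewrite /incident /Defs.other_end; case: eqVneq => //= <- _.
by rewrite eq_sym.
Qed.

Lemma indeg_root O v : is_root O v -> indeg O v = deg v.
Proof.
move=> rv; apply: eq_card => e; rewrite !inE.
by apply/eqP/idP=> [<-|/rv //]; rewrite (incidentE O) eqxx.
Qed.

Lemma indeg_ltP O v : reflect (exists2 e, incident src tgt e v & head O e != v)
  (indeg O v < deg v).
Proof.
have sub : [set e | head O e == v] \subset [set e | incident src tgt e v].
  by apply/subsetP=> e; rewrite !inE (incidentE O) => ->.
apply: (iffP idP) => [lt|[e ie he]].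
  have : ~~ ([set e | incident src tgt e v] \subset [set e | head O e == v]).
    by apply: contraL lt => /subset_leq_card; rewrite -leqNgt.
  by case/subsetPn=> e; rewrite !inE => ? ?; exists e.
by apply: proper_card; apply/properP; split=> //; exists e; rewrite inE.
Qed.

(** All edges at the root [vtx i] point to it, so reversing one moves a unit of in-degree to the
    opposite end, just as the toppling moves a grain. *)
Lemma topple_root O O' i : is_root O (vtx i) ->
  (forall e, O e != O' e -> incident src tgt e (vtx i)) ->
  topple (indeg_config O) i [set e | O e != O' e] = indeg_config O'.
Proof.
move=> ri dif; apply/ffunP=> j; rewrite !ffunE.
have flip e : O e != O' e -> head O e = vtx i /\ head O' e = other_end e (vtx i).
  by move=> d; have hi := ri _ (dif _ d); rewrite -hi other_end_head (head_flip d).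
have same e : O e = O' e -> head O e = head O' e.
  by rewrite /Defs.head => ->.
have -> : #|[set e in [set e | O e != O' e] | other_end e (vtx i) == vtx j]| =
    #|[set e | (O e != O' e) && (other_end e (vtx i) == vtx j)]|.
  by apply: eq_card => e; rewrite !inE.
rewrite /Defs.indeg.
rewrite !cards_sum -big_split /=; have [->|ji] := eqVneq j i; last first.
  rewrite subn0; apply: eq_bigr => e _; have [/same->|/flip[-> ->]] := eqVneq (O e).
    by rewrite addn0.
  by rewrite vtx_eq eq_sym (negbTE ji).
(* Adding the number of reversed edges to both sides removes the truncated subtraction. *)
rewrite mul1n; apply/eqP; rewrite -(eqn_add2r (\sum_e (O e != O' e))) subnK.
  rewrite -big_split; apply/eqP/eq_bigr => e _ /=.
  have [/same->|d] := eqVneq (O e); first by [].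
  have [-> ->] := flip _ d; have := other_end_neq (dif _ d).
  by rewrite eqxx => /negbTE ->.
apply: leq_sum => e _; have [//|/flip[-> _]] := eqVneq (O e).
by rewrite eqxx.
Qed.

(** * Sweeping an orientation *)

(* [sweep k t O] is obtained from [O] by making each vertex [v] with
   [t <= k v] a root, in decreasing order of [k]; thus passing from
   [sweep k t O] to [sweep k t.+1 O] is the toppling of the root of rank [t]. *)
Definition pending (k : 'I_n.+1 -> nat) t v := (v != sink) && (t <= k v).

Definition sweep k t O : orientation E :=
  [ffun e => if pending k t (src e) then
               pending k t (tgt e) && (k (tgt e) < k (src e))
             else pending k t (tgt e) || O e].

Section Sweep.
Variable k : 'I_n.+1 -> nat.
Hypothesis k_inj : injective k.

Lemma pendingS t v : pending k t v = pending k t.+1 v || (v != sink) && (k v == t).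
Proof. by rewrite /pending; case: (v == sink) => //=; lia. Qed.

Lemma pending_vtx i : pending k (k (vtx i)) (vtx i).
Proof. by rewrite /pending leqnn. Qed.

Lemma sweep_head t O e : head (sweep k t O) e =
  if pending k t (tail O e) && (pending k t (head O e) ==> (k (tail O e) < k (head O e)))
  then tail O e else head O e.
Proof.
have nk : k (src e) != k (tgt e) by rewrite (inj_eq k_inj).
rewrite /Defs.head /Defs.tail ffunE; case: (O e);
  case: (pending k t (src e)); case: (pending k t (tgt e)) => //=.
by case: (ltngtP (k (src e)) (k (tgt e))) nk.
Qed.

(** Pending vertices have rank at least [k (vtx i)], and an edge between pending vertices points to
    the lower rank, so [vtx i] wins all its edges. *)
Lemma sweep_root O i : is_root (sweep k (k (vtx i)) O) (vtx i).
Proof.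
move=> e; rewrite sweep_head (incidentE O).
have := head_tail O e; move: (head O e) (tail O e) => h w hw.
case/orP=> /eqP ei; rewrite ei in hw *; rewrite pending_vtx /=.
  by rewrite /pending; case: ifP => // /andP[/andP[_]]; lia.
rewrite ifT //; apply/implyP=> /andP[_].
by rewrite leq_eqVlt => /orP[/eqP/k_inj/eqP|//]; rewrite eq_sym (negbTE hw).
Qed.

Lemma sweep_diff O i e :
  sweep k (k (vtx i)) O e != sweep k (k (vtx i)).+1 O e ->
  incident src tgt e (vtx i).
Proof.
apply: contraR; rewrite negb_or => /andP[si ti].
have eqp v : v != vtx i -> pending k (k (vtx i)) v = pending k (k (vtx i)).+1 v.
  move=> vi; rewrite pendingS; case: (k v =P _) => [/k_inj/eqP|_].
    by rewrite (negbTE vi).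
  by rewrite andbF orbF.
by rewrite !ffunE !eqp.
Qed.

Lemma sweep_skip O t : (forall i, k (vtx i) != t) -> sweep k t.+1 O = sweep k t O.
Proof.
move=> nt; have eqp v : pending k t v = pending k t.+1 v.
  rewrite pendingS; have [->|/vtxP[i ->]] := eqVneq v sink; first by rewrite orbF.
  by rewrite (negbTE (nt i)) orbF.
by apply/ffunP=> e; rewrite !ffunE !eqp.
Qed.

(** In the later sweep [vtx i] has only outgoing edges: to pending neighbours, which claim the
    shared edge, and to lower ranks and the sink, as in [O]. *)
Lemma sweep_full O i : rank_dec k O -> is_root O sink ->
  [set e | sweep k (k (vtx i)) O e != sweep k (k (vtx i)).+1 O e] = inc i.
Proof.
move=> dec rs; apply/setP=> e; rewrite !inE.
apply/idP/idP=> [/sweep_diff //|ie].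
have hi := sweep_root O ie; apply: contraTneq isT => eqO.
have : head (sweep k (k (vtx i)).+1 O) e = vtx i by rewrite -[RHS]hi /Defs.head eqO.
have np : pending k (k (vtx i)).+1 (vtx i) = false by rewrite /pending ltnn andbF.
rewrite sweep_head; move: (dec e) (head_tail O e) (rs e) ie.
rewrite !(incidentE O); move: (head O e) (tail O e) => h w lt hw hs.
case/orP=> /eqP ei; rewrite {}ei in lt hw hs *; rewrite np /=; last first.
  by move/eqP; rewrite (negbTE hw).
rewrite andbT ifT => [/eqP|]; first by rewrite eq_sym (negbTE hw).
rewrite /pending lt andbT; apply/eqP=> ws.
by move: hs; rewrite ws eqxx orbT => /(_ isT)/eqP; rewrite vtx_sink.
Qed.

Lemma sweep_end t O : (forall v, k v < t) -> sweep k t O = O.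
Proof.
by move=> kt; apply/ffunP=> e; rewrite !ffunE /pending !(leqNgt t) !kt !andbF.
Qed.

(** At threshold 0 every vertex but the sink is pending, and each edge has such an end, so the
    original orientation is never consulted. *)
Lemma sweep0 O O' : sweep k 0 O = sweep k 0 O'.
Proof.
apply/ffunP=> e; rewrite !ffunE /pending !andbT; have := loopl e.
by have [->|//] := eqVneq (src e) sink; rewrite eq_sym => ->.
Qed.

Lemma sweep_topples al O :
  (forall i, al i [set e | sweep k (k (vtx i)) O e != sweep k (k (vtx i)).+1 O e]) ->
  exists m, topples al m (indeg_config (sweep k 0 O)) (indeg_config O).
Proof.
move=> alk; suff H t : exists m,
    topples al m (indeg_config (sweep k 0 O)) (indeg_config (sweep k t O)).
  (* A threshold above every rank leaves [O] unchanged. *)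
  have := H (\max_v k v).+1; rewrite (@sweep_end (_.+1)) // => v.
  by rewrite ltnS leq_bigmax.
elim: t => [|t [m IH]]; first by exists 0.
have [/existsP[i /eqP kt]|/existsPn /sweep_skip ->] := boolP [exists i, k (vtx i) == t].
  exists (m + 1); apply: topples_trans IH _; rewrite -kt.
  exists i; eexists; split; [|exact: alk|]; last first.
    by apply: topple_root => [|e]; [exact: sweep_root | exact: sweep_diff].
  by rewrite ffunE indeg_root //; apply: sweep_root.
by exists m.
Qed.

(** The burning configuration of Dhar's algorithm. *)
Definition sink_edges : config n :=
  [ffun i => #|[set e | incident src tgt e (vtx i) && incident src tgt e sink]|].

(** An arc of [A] already points to its lower-ranked end, so the sweep reverses only the edges at
    the sink. *)
Lemma sweep0_config A : rank_dec k A -> is_root A sink ->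
  indeg_config (sweep k 0 A) = addc (indeg_config A) sink_edges.
Proof.
move=> dec rs; apply/ffunP=> i; rewrite !ffunE /Defs.indeg !cards_sum -big_split /=.
apply: eq_bigr => e _; rewrite sweep_head.
move: (dec e) (head_tail A e) (rs e); rewrite !(incidentE A).
move: (head A e) (tail A e) => h w lt hw hs.
have ws : w != sink.
  by apply: contraNneq hw => ws; rewrite hs ws ?eqxx ?orbT.
rewrite /pending ws [k w < k h]ltnNge (ltnW lt) /= andbT (negbTE ws) orbF implybF.
have [->|hs'] := eqVneq h sink; last by rewrite andbF addn0.
by rewrite andbT [sink == _]eq_sym vtx_sink.
Qed.

Lemma asm_round A : rank_dec k A -> is_root A sink ->
  exists m, topples asm_al m (addc (indeg_config A) sink_edges) (indeg_config A).
Proof.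
move=> dec rs; rewrite -sweep0_config //; apply: sweep_topples => i.
exact: sweep_full.
Qed.

Lemma asm_rounds A r : rank_dec k A -> is_root A sink ->
  exists m, topples asm_al m (addc (indeg_config A) (mulc r sink_edges)) (indeg_config A).
Proof.
move=> dec rs; elim: r => [|r [m IH]].
  by exists 0; apply/ffunP=> i; rewrite !ffunE addn0.
have [m' t] := asm_round dec rs.
exists (m' + m); apply: topples_trans IH.
have -> : addc (indeg_config A) (mulc r.+1 sink_edges) =
          addc (addc (indeg_config A) sink_edges) (mulc r sink_edges).
  by apply/ffunP=> i; rewrite !ffunE mulSn addnA.
exact/topples_addc/t/asm_al_sub.
Qed.

(** The fully swept orientation is the same for [A] and [O], so partial topplings can unwind it to
    [O], turning only the edges that must change. *)
Lemma ssm_sweep A O : rank_dec k A -> is_root A sink ->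
  exists m, topples ssm_al m (addc (indeg_config A) sink_edges) (indeg_config O).
Proof.
move=> dec rs; rewrite -sweep0_config // (sweep0 A O); apply: sweep_topples => i.
by apply/subsetP=> e; rewrite !inE => /sweep_diff.
Qed.

End Sweep.

(** * Filling the graph from the sink *)

Lemma adjP u v : adj src tgt u v -> exists e, incident src tgt e u /\ other_end e u = v.
Proof.
case/existsP=> e /orP[]/andP[/eqP su /eqP tv]; exists e;
  rewrite /incident /Defs.other_end ?su ?tv eqxx ?orbT //.
by split=> //; case: eqVneq => // <-.
Qed.

Lemma adj_sym u v : adj src tgt u v = adj src tgt v u.
Proof. by apply: eq_existsb => e; rewrite orbC. Qed.

(** Each toppling of [vtx i] uses up at most [deg (vtx i)] grains and sends at least one to [vtx j],
    so the supply lasts for [r] topplings. *)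
Lemma asm_fill_neighbour i j r x : i != j -> adj src tgt (vtx i) (vtx j) ->
  r * deg (vtx i) <= x i ->
  exists m y, topples asm_al m x y /\ r + x j <= y j.
Proof.
move=> ij /adjP[e [ie oe]]; elim: r x => [|r IH] x xi; first by exists 0, x.
have xd : deg (vtx i) <= x i by move: xi; rewrite mulSn; lia.
have [|m [y [t yj]]] := IH (topple x i (inc i)).
  rewrite ffunE eqxx mul1n; apply: leq_trans (leq_sub2r _ (leq_addr _ _)).
  by move: xi; rewrite mulSn /Defs.deg; lia.
exists m.+1, y; split=> [|//].
  by exists i, (inc i).
apply: leq_trans yj; rewrite ffunE eq_sym (negbTE ij) subn0.
have : 0 < #|[set e in inc i | other_end e (vtx i) == vtx j]|.
  by apply/card_gt0P; exists e; rewrite !inE ie oe eqxx.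
lia.
Qed.

(** Induction on a path from the sink: copies of [sink_edges] supply the first vertex, and each
    vertex feeds the next. *)
Lemma asm_fill_vertex i N :
  exists r m x, topples asm_al m (mulc r sink_edges) x /\ N <= x i.
Proof.
have /connectP[p] := conn sink (vtx i).
elim/last_ind: p i N => [|p w IH] i N /=.
  by move=> _ /eqP; rewrite vtx_sink.
rewrite rcons_path last_rcons => /andP[pp a] wi; subst w.
have [us|/vtxP[j uj]] := eqVneq (last sink p) sink.
  exists N, 0, (mulc N sink_edges); split=> //; rewrite !ffunE leq_pmulr //.
  have [e [ie oe]] := adjP a; rewrite us in ie oe.
  apply/card_gt0P; exists e; rewrite !inE ie andbT -oe.
  move: ie; rewrite /incident /Defs.other_end.
  by case: eqVneq => [_|_] /=; rewrite eqxx ?orbT.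
rewrite uj in a; have [r [m [x [t xj]]]] := IH j (N * deg (vtx j)) pp (esym uj).
have ji : j != i.
  by apply: contraTneq a => ->; apply/negP=> /adjP[e [/other_end_neq/eqP h /h]].
have [m' [y [t' yi]]] := asm_fill_neighbour ji a xj.
exists r, (m + m'), y; split; first exact: topples_trans t t'.
exact: leq_trans (leq_addr _ _) yi.
Qed.

Lemma addcC x y : addc x y = addc y x.
Proof. by apply/ffunP=> i; rewrite !ffunE addnC. Qed.

(** Vertices are filled one at a time; the topplings for one remain legal on top of the grains
    gathered for the others. *)
Lemma asm_fill N :
  exists r m x, topples asm_al m (mulc r sink_edges) x /\ forall i, N <= x i.
Proof.
suff H (l : seq 'I_n) : exists r m x,
    topples asm_al m (mulc r sink_edges) x /\ forall i, i \in l -> N <= x i.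
  have [r [m [x [t xN]]]] := H (enum 'I_n).
  by exists r, m, x; split=> // i; rewrite xN ?mem_enum.
elim: l => [|i l [r [m [x [t xN]]]]]; first by exists 0, 0; eexists.
have [r' [m' [y [t' yN]]]] := asm_fill_vertex i N.
exists (r + r'), (m + m'), (addc x y); split=> [|j].
  have -> : mulc (r + r') sink_edges = addc (mulc r sink_edges) (mulc r' sink_edges).
    by apply/ffunP=> j; rewrite !ffunE mulnDl.
  apply: topples_trans (topples_addc asm_al_sub _ t) _.
  by rewrite !(addcC x); apply: topples_addc t'; apply: asm_al_sub.
rewrite inE ffunE => /orP[/eqP->|/xN xj]; first exact: leq_trans yN (leq_addl _ _).
exact: leq_trans xj (leq_addr _ _).
Qed.

(** * Rankings *)

(** Encodes the lexicographic order of the pairs [(f v, v)], refining [f] to an injective rank. *)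
Definition tie_break (f : 'I_n.+1 -> nat) v := f v * n.+1 + v.

Lemma tie_break_inj f : injective (tie_break f).
Proof.
by move=> u v /(congr1 (modn^~ n.+1)); rewrite !modnMDl !modn_small // => /val_inj.
Qed.

Lemma tie_break_lt f u v : f u < f v -> tie_break f u < tie_break f v.
Proof. by rewrite /tie_break; have := ltn_ord u; nia. Qed.

(** [f] is the distance to the sink; the last edge of a shortest path leads back to a closer
    vertex. *)
Lemma distance_rank : exists f : 'I_n.+1 -> nat, (forall i, f sink < f (vtx i)) /\
  forall i, exists2 e, incident src tgt e (vtx i) &
                       f (other_end e (vtx i)) < f (vtx i).
Proof.
(* Tuples of fixed length make [P] a boolean predicate, as [ex_minn] requires. *)
pose P v m := [exists p : m.-tuple 'I_n.+1,
  path (adj src tgt) sink p && (last sink p == v)].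
have PI p v : path (adj src tgt) sink p -> last sink p = v -> P v (size p).
  by move=> pp pv; apply/existsP; exists (in_tuple p); rewrite pp /= pv.
have exP v : exists m, P v m.
  by have /connectP[p pp pv] := conn sink v; exists (size p); apply: PI.
exists (fun v => ex_minn (exP v)); split=> i.
  case: ex_minnP => m _ /(_ 0 (PI [::] sink isT erefl)); rewrite leqn0 => /eqP->.
  by case: ex_minnP => -[|//] /existsP[p]; rewrite (tuple0 p) /= sink_vtx.
case: ex_minnP => m /existsP[[p sp] /= /andP[pp pv]] _.
case/lastP: p sp pp pv => [|p w]; first by rewrite /= sink_vtx.
rewrite size_rcons rcons_path last_rcons => /eqP <- /andP[pp] a /eqP wi; subst w.
move: a; rewrite adj_sym => /adjP[e [ie oe]]; exists e => //.
by case: ex_minnP => m' _ min; rewrite ltnS; apply/min/PI.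
Qed.

(** Each edge points to its end nearer to the sink, ties broken by vertex number. A vertex other
    than the sink has an edge out to a nearer neighbour, hence an in-degree below its degree. *)
Lemma acyclic_orientation_exists : exists k A,
  [/\ injective k, rank_dec k A, is_root A sink & stable (indeg_config A)].
Proof.
have [f [f0 fS]] := distance_rank; pose k := tie_break f.
pose A : orientation E := [ffun e => k (tgt e) < k (src e)].
have dec : rank_dec k A.
  move=> e; rewrite /Defs.head /Defs.tail ffunE; case: (ltnP (k (tgt e))) => //= le.
  by rewrite ltn_neqAle le (inj_eq (@tie_break_inj f)) loopl.
exists k, A; split=> //; first exact: tie_break_inj.
- move=> e; rewrite (incidentE A) => /orP[/eqP //|/eqP ts].
  have := dec e; rewrite ts; case: (eqVneq (head A e) sink) => // /vtxP[i ->].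
  by rewrite ltnNge (ltnW (tie_break_lt (f0 i))).
- apply/stableP=> i; rewrite ffunE; apply/indeg_ltP.
  have [e ie lt] := fS i; exists e => //; apply: contraTneq isT => hi.
  have := dec e; rewrite -other_end_head hi.
  by rewrite ltnNge (ltnW (tie_break_lt lt)).
Qed.

(** The number of vertices reachable from [v] drops along every arc: by acyclicity the tail is not
    reachable from the head. *)
Lemma acyclic_rank O : acyclic src tgt O -> exists2 k, injective k & rank_dec k O.
Proof.
move=> ac; exists (tie_break (fun v => #|connect (arc O) v|)).
  exact: tie_break_inj.
move=> e; apply: tie_break_lt; apply: proper_card.
have a : arc O (tail O e) (head O e) by apply/existsP; exists e; rewrite !eqxx.
apply/properP; split.
  by apply/subsetP=> v; rewrite !unfold_in => /(connect_trans (connect1 a)).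
by exists (tail O e); [exact: connect0 | exact: ac a].
Qed.

Lemma rank_acyclic k O : rank_dec k O -> acyclic src tgt O.
Proof.
move=> dec; have lt u v : arc O u v -> k v < k u.
  by case/existsP=> e /andP[/eqP<- /eqP<-].
have le u v : connect (arc O) u v -> k v <= k u.
  case/connectP=> p; elim: p u => [|w p IH] u /= => [_ -> //|/andP[/lt uw pp] pv].
  by apply: leq_trans (IH _ pp pv) (ltnW uw).
by move=> u v /lt uv; apply/negP=> /le; rewrite leqNgt uv.
Qed.

(** * Recurrent configurations *)

(** The in-degree equals the degree exactly at roots, so stability means that no vertex but the sink
    is a root. *)
Lemma stable_sink_rooted O : stable (indeg_config O) -> is_root O sink ->
  sink_rooted src tgt O.
Proof.
move=> /stableP st rs; split=> // v rv; apply/eqP/contraT => /vtxP[i vi].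
by have := st i; rewrite ffunE -vi indeg_root // ltnn.
Qed.

Lemma sink_rooted_stable O : sink_rooted src tgt O -> stable (indeg_config O).
Proof.
case=> _ ur; apply/stableP=> i; rewrite ffunE ltnNge; apply/negP=> le.
suff /ur : is_root O (vtx i) by move/eqP; rewrite vtx_sink.
move=> e ie; apply/eqP; apply: contraTT le => he; rewrite -ltnNge.
by apply/indeg_ltP; exists e.
Qed.

(* Let [c] be the configuration. Adding [r] copies of [sink_edges] to [c] leads
   back to [c], but also to some [x + c] above [max_stable]; by confluence
   [x + c] stabilises to [c]. *)
Lemma asm_chain_acyclic k A : injective k -> rank_dec k A -> is_root A sink ->
  stable (indeg_config A) ->
  clos_refl_trans _ (chain_step src tgt asm_step) max_stable (indeg_config A).
Proof.
move=> kinj dec rs st.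
apply: (@chain_sub (topple_step asm_al)); first exact: topple_step_asm.
have [r [m [x [t xN]]]] := asm_fill (\max_i max_stable i).
have [m1 t1] := asm_rounds kinj r dec rs.
have := topples_addc asm_al_sub (indeg_config A) t.
rewrite addcC => t2; have [m2 t3] := asm_confluent st t1 t2.
pose d : config n := [ffun i => (x i + indeg_config A i) - max_stable i].
apply: (@topples_chain _ asm_al_sub m2 _ d) => //; first exact: stable_max st.
have -> // : addc max_stable d = addc x (indeg_config A).
apply/ffunP=> i; rewrite [LHS]ffunE [X in _ + X]ffunE [RHS]ffunE subnKC //.
apply: leq_trans (leq_addr _ _); apply: leq_trans (xN i).
exact: (leq_bigmax (F := fun i => max_stable i)).
Qed.

Lemma ssm_chain_sink_rooted O : stable (indeg_config O) ->
  clos_refl_trans _ (chain_step src tgt ssm_step) max_stable (indeg_config O).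
Proof.
move=> st; have [k [A [kinj dec rs stA]]] := acyclic_orientation_exists.
apply: (@rt_trans _ _ _ (indeg_config A)).
  by apply: chain_sub (asm_chain_acyclic kinj dec rs stA); apply: asm_step_ssm.
have [m t] := ssm_sweep kinj O dec rs.
exact: (topples_chain ssm_al_sub stA st t).
Qed.

(** An edge has head [tgt e] when its value is true, so the value [src e == vtx i] turns an edge of
    [S] at [vtx i] away from it. *)
Definition point_out O i S : orientation E :=
  [ffun e => if e \in S then src e == vtx i else O e].

Lemma head_point_out O i S e :
  head (point_out O i S) e = if e \in S then other_end e (vtx i) else head O e.
Proof.
by rewrite /Defs.head /Defs.other_end ffunE; case: (e \in S).
Qed.

Lemma point_out_root O i S : S \subset inc i -> is_root O sink ->
  is_root (point_out O i S) sink.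
Proof.
move=> /subsetP si rs e ie; rewrite head_point_out.
case: ifP => [/si|_]; last exact: rs.
rewrite inE; move: ie; rewrite /incident /Defs.other_end.
case: (eqVneq (src e) (vtx i)) => [->|_ /=]; first by rewrite vtx_sink => /eqP.
by case: (eqVneq (src e) sink) => //= _ /eqP ->; rewrite sink_vtx.
Qed.

(** A vertex other than [i] gains at most as much in-degree as grains. At [i] at least
    [deg (vtx i) - #|S|] grains stay, and only edges outside [S] can still enter. *)
Lemma topple_point_out c O i S : S \subset inc i -> deg (vtx i) <= c i ->
  (forall j, indeg O (vtx j) <= c j) ->
  forall j, indeg (point_out O i S) (vtx j) <= topple c i S j.
Proof.
move=> si ci le j; rewrite ffunE.
have out e : e \in S -> other_end e (vtx i) != vtx i.
  by move/(subsetP si); rewrite inE; apply: other_end_neq.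
have [->|ji] := eqVneq j i; last first.
  rewrite subn0; apply: leq_trans (leq_add (le j) (leqnn _)).
  rewrite /Defs.indeg !cards_sum -big_split; apply: leq_sum => e _.
  by rewrite head_point_out /=; case: (e \in S); rewrite ?leq_addl ?addn0.
rewrite mul1n; apply: leq_trans (leq_sub2r _ (leq_addr _ _)).
apply: leq_trans (leq_sub2r _ ci).
rewrite leq_subRL; last exact: subset_leq_card.
rewrite /Defs.deg /Defs.indeg -cardsUI (_ : _ :&: _ = set0) ?cards0 ?addn0.
  apply: subset_leq_card; apply/subsetP=> e; rewrite !inE.
  case/orP=> [/(subsetP si)|]; first by rewrite inE.
  by rewrite (incidentE (point_out O i S)) => ->.
apply/setP=> e; rewrite !inE head_point_out; case: ifP => //= /out.
by move/negbTE.
Qed.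

(** The property [P] holds at [max_stable] by [acyclic_orientation_exists] and survives adding
    grains and toppling. *)
Lemma SR_orientation c : SR src tgt c ->
  exists2 O, is_root O sink & forall i, indeg O (vtx i) <= c i.
Proof.
move=> rc; have sc : stable c by case: rc.
pose P x := exists2 O, is_root O sink & forall i, indeg O (vtx i) <= x i.
have {}rc := (recurrentP ssm_step sc).1 rc.
apply: (clos_rt_inv (P := P)) rc _ => [x y [_ [_ [i xy]]] [O rO le]|].
  apply: (clos_rt_inv (P := P)) xy _ => [u v [j [uj [S [sS ->]]]] [O' rO' le']|].
    exists (point_out O' j S); first exact: point_out_root.
    exact: topple_point_out.
  by exists O => // j; rewrite ffunE; apply: leq_trans (le j) (leq_addr _ _).
have [k [A [_ _ rs /stable_le_max le]]] := acyclic_orientation_exists.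
by exists A => // i; have := le i; rewrite ffunE.
Qed.

Lemma DR_orientation c : DR src tgt c ->
  exists k O, [/\ rank_dec k O, is_root O sink & forall i, indeg O (vtx i) <= c i].
Proof.
move=> rc; have sc : stable c by case: rc.
pose P x := exists k O,
  [/\ rank_dec k O, is_root O sink & forall i, indeg O (vtx i) <= x i].
have {}rc := (recurrentP asm_step sc).1 rc.
apply: (clos_rt_inv (P := P)) rc _ => [x y [_ [_ [i xy]]] [k [O [dec rO le]]]|].
  apply: (clos_rt_inv (P := P)) xy _ => [u v [j [uj ->]] [k' [O' [dec' rO' le']]]|].
    (* All edges at the toppled vertex now point outwards, so it receives a rank above all
       others. *)
    pose k2 v := if v == vtx j then (\max_w k' w).+1 else k' v.
    exists k2, (point_out O' j (inc j)); split.
    - move=> e; rewrite -other_end_head head_point_out inE /k2.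
      have [ie|nie] := boolP (incident src tgt e (vtx j)).
        rewrite (negbTE (other_end_neq ie)).
        have -> : other_end e (other_end e (vtx j)) = vtx j.
          move: ie (loopl e); rewrite /incident /Defs.other_end.
          case: eqVneq => [<-|] /=; first by case: eqVneq => // ->.
          by rewrite eqxx => _ /eqP.
        by rewrite eqxx ltnS leq_bigmax.
      move: nie; rewrite other_end_head (incidentE O').
      by rewrite negb_or => /andP[/negbTE -> /negbTE ->]; apply: dec'.
    - exact: point_out_root.
    - exact: topple_point_out.
  exists k, O; split=> // j; rewrite ffunE.
  exact: leq_trans (le j) (leq_addr _ _).
have [k [A [_ dec rs /stable_le_max le]]] := acyclic_orientation_exists.
by exists k, A; split=> // i; have := le i; rewrite ffunE.
Qed.

(** * Grain counts, minimality and uniqueness *)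

Lemma sum_indeg O : \sum_v indeg O v = #|E|.
Proof.
rewrite -sum1_card (partition_big (head O) predT) //=.
by apply: eq_bigr => v _; rewrite /Defs.indeg -sum1dep_card.
Qed.

Lemma sum_indeg_config O : is_root O sink ->
  \sum_i indeg_config O i = #|E| - deg sink.
Proof.
move=> rs; rewrite -(sum_indeg O) big_ord_recl indeg_root // addKn.
by apply: eq_bigr => i _; rewrite ffunE.
Qed.

(* Both configurations contain [#|E| - deg sink] grains. *)
Lemma indeg_config_le O O' : is_root O sink -> is_root O' sink ->
  (forall i, indeg_config O' i <= indeg_config O i) -> indeg_config O' = indeg_config O.
Proof.
move=> rO rO' le; apply/ffunP=> i.
have : \sum_j (indeg_config O j - indeg_config O' j) = 0.
  by rewrite sumnB // !sum_indeg_config // subnn.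
move/eqP; rewrite sum_nat_eq0 => /forallP/(_ i); rewrite subn_eq0 /= => le'.
by apply/eqP; rewrite eqn_leq le le'.
Qed.

(** Shared by both models, with [Q] trivial or acyclicity. A minimal [c] lies above some
    [indeg_config O] in [P], hence equals it. Conversely, an [x] in [P] below [indeg_config O] lies
    above an [indeg_config O'] with equally many grains, which squeezes [x]. *)
Lemma minimal_indeg (P : config n -> Prop) (Q : orientation E -> Prop) c :
  (forall x, P x -> stable x) ->
  (forall x, P x -> exists O, [/\ Q O, is_root O sink & forall i, indeg O (vtx i) <= x i]) ->
  (forall O, Q O -> sink_rooted src tgt O -> P (indeg_config O)) ->
  minimal_in P c <->
  exists O, [/\ sink_rooted src tgt O, Q O & config_is_indeg src tgt c O].
Proof.
move=> Pst Pe Pi; split=> [[Pc min]|[O [sO qO cO]]].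
  have [O [qO rO le]] := Pe _ Pc.
  have le' i : indeg_config O i <= c i by rewrite ffunE.
  have sO := stable_sink_rooted (stable_le le' (Pst _ Pc)) rO.
  exists O; split=> // i; rewrite -(min _ (Pi _ qO sO) le').
  by rewrite ffunE.
have {cO} -> : c = indeg_config O by apply/ffunP=> i; rewrite cO ffunE.
split=> [|x Px le]; first exact: Pi.
have [O' [_ rO' le']] := Pe _ Px.
have leO i : indeg_config O' i <= x i by rewrite ffunE.
have eO := indeg_config_le sO.1 rO' (fun i => leq_trans (leO i) (le i)).
by apply/ffunP=> i; apply/eqP; rewrite eqn_leq le -{1}eO leO.
Qed.

Lemma minimal_SR c : minimal_in (SR src tgt) c <->
  exists O, sink_rooted src tgt O /\ config_is_indeg src tgt c O.
Proof.
have [|x /SR_orientation[O rO le]|O _ sO|H1 H2] :=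
    @minimal_indeg (SR src tgt) (fun=> True) c.
- by move=> x [].
- by exists O.
- apply/recurrentP; first exact: sink_rooted_stable.
  exact/ssm_chain_sink_rooted/sink_rooted_stable.
- split=> [/H1[O []]|[O [sO cO]]]; first by exists O.
  by apply: H2; exists O.
Qed.

Lemma minimal_DR c : minimal_in (DR src tgt) c <->
  exists O, sink_rooted src tgt O /\ acyclic src tgt O /\ config_is_indeg src tgt c O.
Proof.
have [|x /DR_orientation[k [O [dec rO le]]]|O /acyclic_rank[k kinj dec] sO|H1 H2] :=
    @minimal_indeg (DR src tgt) (acyclic src tgt) c.
- by move=> x [].
- by exists O; split=> //; apply: rank_acyclic dec.
- have st := sink_rooted_stable sO; apply/recurrentP => //.
  exact: asm_chain_acyclic kinj dec sO.1 st.
- split=> [/H1[O [? ? ?]]|[O [sO [aO cO]]]]; first by exists O.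
  by apply: H2; exists O.
Qed.

(** The configuration does not record the sink, but there both in-degrees equal its degree. *)
Lemma sink_rooted_score_equiv c O1 O2 :
  sink_rooted src tgt O1 -> config_is_indeg src tgt c O1 ->
  sink_rooted src tgt O2 -> config_is_indeg src tgt c O2 ->
  score_equiv src tgt O1 O2.
Proof.
move=> [r1 _] c1 [r2 _] c2 v; have [->|/vtxP[i ->]] := eqVneq v sink.
  by rewrite !indeg_root.
by rewrite -c1 -c2.
Qed.

(* The edges on which the two orientations differ form a balanced subgraph of
   [O1]; a differing edge whose tail has maximal rank contradicts this. *)
Lemma acyclic_score_unique O1 O2 : acyclic src tgt O1 ->
  score_equiv src tgt O1 O2 -> O1 = O2.
Proof.
move=> /acyclic_rank[k _ dec] sc; apply/ffunP=> e0; apply/eqP; apply: contraT => d0.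
case: (@arg_maxnP _ e0 (fun e => O1 e != O2 e) (fun e => k (tail O1 e)) d0) => e d max.
have in_out : #|[set e' | (O1 e' != O2 e') && (head O1 e' == tail O1 e)]| =
              #|[set e' | (O1 e' != O2 e') && (tail O1 e' == tail O1 e)]|.
  (* The arcs on which [O1] and [O2] agree complete the two counts to the in-degrees in [O1] and in
     [O2], since a reversed arc enters its old tail. *)
  apply/eqP; rewrite -(eqn_add2r #|[set e' | (O1 e' == O2 e') && (head O1 e' == tail O1 e)]|).
  rewrite !cards_sum -!big_split; apply/eqP; transitivity (indeg O1 (tail O1 e)).
    rewrite /Defs.indeg cards_sum; apply: eq_bigr => e' _ /=.
    by case: eqVneq => //=; rewrite addn0.
  rewrite sc /Defs.indeg cards_sum; apply: eq_bigr => e' _ /=.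
  have [ee|/head_flip ->] := eqVneq (O1 e') (O2 e'); last by rewrite addn0.
  by rewrite /Defs.head ee.
have : 0 < #|[set e' | (O1 e' != O2 e') && (tail O1 e' == tail O1 e)]|.
  by apply/card_gt0P; exists e; rewrite !inE d eqxx.
rewrite -in_out => /card_gt0P[e']; rewrite !inE => /andP[d' /eqP h'].
by have := max _ d'; have := dec e'; rewrite h' /=; lia.
Qed.

End Sandpile.

Theorem theorem2p4 (n : nat) (E : finType) (src tgt : E -> 'I_n.+1) :
  is_graph src tgt ->
  forall c : config n, stable src tgt c ->
  [/\ minimal_in (SR src tgt) c <->
        (exists O : orientation E, sink_rooted src tgt O /\ config_is_indeg src tgt c O),
      minimal_in (DR src tgt) c <->
        (exists O : orientation E, sink_rooted src tgt O /\ acyclic src tgt O /\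
                                   config_is_indeg src tgt c O),
      minimal_in (SR src tgt) c ->
        forall O1 O2 : orientation E,
          sink_rooted src tgt O1 -> config_is_indeg src tgt c O1 ->
          sink_rooted src tgt O2 -> config_is_indeg src tgt c O2 ->
          score_equiv src tgt O1 O2
    & minimal_in (DR src tgt) c ->
        forall O1 O2 : orientation E,
          sink_rooted src tgt O1 -> acyclic src tgt O1 -> config_is_indeg src tgt c O1 ->
          sink_rooted src tgt O2 -> acyclic src tgt O2 -> config_is_indeg src tgt c O2 ->
          O1 = O2].
Proof.
move=> [loopl conn] c _; split.
- exact: minimal_SR.
- exact: minimal_DR.
- by move=> _ O1 O2; apply: sink_rooted_score_equiv.
- move=> _ O1 O2 s1 a1 c1 s2 _ c2; apply: acyclic_score_unique a1 _.
  exact: sink_rooted_score_equiv s1 c1 s2 c2.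
Qed.
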